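(* Let $T:V\to\mathfrak g$ be a $\Phi$-twisted Rota-Baxter operator on a 3-Leibniz algebra $(\mathfrak g,[\cdot,\cdot,\cdot]_{\mathfrak g})$ with respect to a representation $(V;\rho^l,\rho^m,\rho^r)$. If two formal deformations $\widetilde T_t=\sum_{i\ge0}\widetilde{\mathcal T}_it^i$ and $T_t=\sum_{i\ge0}\mathcal T_it^i$ of $T$ are equivalent, then their infinitesimals $\widetilde{\mathcal T}_1$ and $\mathcal T_1$ are in the same cohomology class in $\mathrm{HH}^1_T(V,\mathfrak g)$.
   Context: All vector spaces are over an algebraically closed field $\mathbb K$ of characteristic $0$. A 3-Leibniz algebra is a vector space $\mathfrak g$ with a trilinear map $[\cdot,\cdot,\cdot]_{\mathfrak g}$ satisfying $[a,b,[x,y,z]_{\mathfrak g}]_{\mathfrak g}=[[a,b,x]_{\mathfrak g},y,z]_{\mathfrak g}+[x,[a,b,y]_{\mathfrak g},z]_{\mathfrak g}+[x,y,[a,b,z]_{\mathfrak g}]_{\mathfrak g}$. A representation of $\mathfrak g$ is a vector space $V$ with trilinear maps $\rho^l:\mathfrak g\otimes\mathfrak g\otimes V\to V$, $\rho^m:\mathfrak g\otimes V\otimes\mathfrak g\to V$, $\rho^r:V\otimes\mathfrak g\otimes\mathfrak g\to V$ such that for all $a,b,x,y,z\in\mathfrak g$, $u\in V$: $\rho^l(a,b,\rho^l(x,y,u))=\rho^l([a,b,x]_{\mathfrak g},y,u)+\rho^l(x,[a,b,y]_{\mathfrak g},u)+\rho^l(x,y,\rho^l(a,b,u))$; $\rho^l(a,b,\rho^m(x,u,z))=\rho^m([a,b,x]_{\mathfrak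 g},u,z)+\rho^m(x,\rho^l(a,b,u),z)+\rho^m(x,u,[a,b,z]_{\mathfrak g})$; $\rho^l(a,b,\rho^r(u,y,z))=\rho^r(\rho^l(a,b,u),y,z)+\rho^r(u,[a,b,y]_{\mathfrak g},z)+\rho^r(u,y,[a,b,z]_{\mathfrak g})$; $\rho^m(a,u,[x,y,z]_{\mathfrak g})=\rho^r(\rho^m(a,u,x),y,z)+\rho^m(x,\rho^m(a,u,y),z)+\rho^l(x,y,\rho^m(a,u,z))$; $\rho^r(u,b,[x,y,z]_{\mathfrak g})=\rho^r(\rho^r(u,b,x),y,z)+\rho^m(x,\rho^r(u,b,y),z)+\rho^l(x,y,\rho^r(u,b,z))$. $\Phi$ is a 2-cocycle: a trilinear map $\Phi:\mathfrak g\otimes\mathfrak g\otimes\mathfrak g\to V$ with $\Phi(a,b,[x,y,z]_{\mathfrak g})+\rho^l(a,b,\Phi(x,y,z))=\Phi([a,b,x]_{\mathfrak g},y,z)+\Phi(x,[a,b,y]_{\mathfrak g},z)+\Phi(x,y,[a,b,z]_{\mathfrak g})+\rho^l(x,y,\Phi(a,b,z))+\rho^m(x,\Phi(a,b,y),z)+\rho^r(\Phi(a,b,x),y,z)$. A linear map $T:V\to\mathfrak g$ is a $\Phi$-twisted Rota-Baxter operator if $[Tu,Tv,Tw]_{\mathfrak g}=T\big(\rho^l(Tu,Tv,w)+\rho^m(Tu,v,Tw)+\rho^r(u,Tv,Tw)+\Phi(Tu,Tv,Tw)\big)$ for all $u,v,w\in V$. Cohomology of $T$ in degree 1: a linear map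 $f:V\to\mathfrak g$ is a 1-cocycle ($\partial_Tf=0$, $f\in\mathrm Z^1_T(V,\mathfrak g)$) if for all $u,v,w\in V$ $$\begin{aligned}0=&-f\big(\rho^l(Tu,Tv,w)+\rho^m(Tu,v,Tw)+\rho^r(u,Tv,Tw)+\Phi(Tu,Tv,Tw)\big)\\&+[Tu,Tv,f(w)]_{\mathfrak g}-T\big(\rho^m(Tu,v,f(w))+\rho^r(u,Tv,f(w))+\Phi(Tu,Tv,f(w))\big)\\&+[Tu,f(v),Tw]_{\mathfrak g}-T\big(\rho^l(Tu,f(v),w)+\rho^r(u,f(v),Tw)+\Phi(Tu,f(v),Tw)\big)\\&+[f(u),Tv,Tw]_{\mathfrak g}-T\big(\rho^l(f(u),Tv,w)+\rho^m(f(u),v,Tw)+\Phi(f(u),Tv,Tw)\big).\end{aligned}$$ 0-cochains are elements of $\mathfrak g\otimes\mathfrak g$, and $\partial_T$ on 0-cochains is the linear map $\wp$ with $\wp(a\otimes b)(u)=T\rho^l(a,b,u)+T\Phi(a,b,Tu)-[a,b,Tu]_{\mathfrak g}$, which takes values in 1-cocycles. $\mathrm B^1_T(V,\mathfrak g)=\wp(\mathfrak g\otimes\mathfrak g)$ and $\mathrm{HH}^1_T(V,\mathfrak g)=\mathrm Z^1_T/\mathrm B^1_T$. Formal deformations: all operations are extended $\mathbb K[[t]]$-(tri)linearly (coefficientwise) to $\mathfrak g[[t]]$ and $V[[t]]$. A formal deformation of $T$ is $T_t=\sum_{i\ge0}\mathcal T_it^i$, $\mathcal T_i\in\mathrm{Hom}(V,\mathfrak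 g)$, $\mathcal T_0=T$, with $[T_tu,T_tv,T_tw]_{\mathfrak g}=T_t\big(\rho^l(T_tu,T_tv,w)+\rho^m(T_tu,v,T_tw)+\rho^r(u,T_tv,T_tw)+\Phi(T_tu,T_tv,T_tw)\big)$ for all $u,v,w\in V$. Its infinitesimal is $\mathcal T_1$, which is a 1-cocycle. Two formal deformations $\widetilde T_t$, $T_t$ of $T$ are equivalent if there exist $a\otimes b\in\mathfrak g\otimes\mathfrak g$, $\eta_i\in\mathrm{End}(\mathfrak g)$ and $\zeta_i\in\mathrm{End}(V)$ ($i\ge2$) such that $f_t=\mathrm{Id}_{\mathfrak g}+t[a,b,\cdot]_{\mathfrak g}+\sum_{i\ge2}\eta_it^i$ and $g_t=\mathrm{Id}_V+t\big(\rho^l(a,b,\cdot)+\Phi(a,b,T\cdot)\big)+\sum_{i\ge2}\zeta_it^i$ satisfy, for all $x,y,z\in\mathfrak g$, $u\in V$: (i) $f_t[x,y,z]_{\mathfrak g}=[f_t(x),f_t(y),f_t(z)]_{\mathfrak g}$; (ii) $g_t\rho^l(x,y,u)=\rho^l(f_t(x),f_t(y),g_t(u))$, $g_t\rho^m(x,u,y)=\rho^m(f_t(x),g_t(u),f_t(y))$, $g_t\rho^r(u,x,y)=\rho^r(g_t(u),f_t(x),f_t(y))$, $g_t\Phi(x,y,z)=\Phi(f_t(x),f_t(y),f_t(z))$; (iii) $f_t(\widetilde T_tu)=T_tg_t(u)$. *)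

(* Defs.v *)
From HB Require Import structures.
From mathcomp Require Import all_boot all_algebra.
From mathcomp Require Import boolp functions.
Import GRing.Theory.

Set Implicit Arguments.
Unset Strict Implicit.
Unset Printing Implicit Defensive.

Local Open Scope ring_scope.
Local Open Scope quotient_scope.

(** Every element of U (x) V is a finite sum of pure tensors, so U (x) V is
    built as the quotient of the formal sums [seq (U * V)] that identifies two
    sums exactly when no bilinear map into a vector space separates them;
    [tens_bilinear], [tens_liftE] and [tens_lift_unique] are its universal
    property. *)
Section Tensor.
Variables (K : fieldType) (U V : lmodType K).

Definition tens_eval (W : lmodType K) (beta : U -> V -> W) (s : seq (U * V)) : W :=
  \sum_(p <- s) beta p.1 p.2.

Definition tens_equiv (s s' : seq (U * V)) : bool :=
  `[< forall (W : lmodType K) (beta : {bilinear U -> V -> W}),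
        tens_eval beta s = tens_eval beta s' >].

Lemma tens_equiv_is_equiv : equiv_class_of tens_equiv.
Proof.
split=> [s|s s'|s' s s''].
- by apply/asboolP.
- by apply/asboolP/asboolP => h W beta; rewrite h.
- by move=> /asboolP h /asboolP h'; apply/asboolP => W beta; rewrite h h'.
Qed.

Canonical tens_equiv_equiv := EquivRelPack tens_equiv_is_equiv.

Definition tensor : Type := {eq_quot tens_equiv}.
HB.instance Definition _ := EqQuotient.on tensor.
HB.instance Definition _ := Choice.on tensor.

Definition tens (u : U) (v : V) : tensor := \pi_tensor [:: (u, v)].

Definition tens_lift (W : lmodType K) (beta : {bilinear U -> V -> W})
  (x : tensor) : W := tens_eval beta (repr x).

Implicit Type W : lmodType K.

Lemma tens_lift_pi W (beta : {bilinear U -> V -> W}) s :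
  tens_lift beta (\pi_tensor s) = tens_eval beta s.
Proof.
have /eqP : repr (\pi_tensor s) = s %[mod tensor] by rewrite reprK.
by rewrite piE => /asboolP/(_ W beta).
Qed.

Lemma tensorP (x y : tensor) :
  (forall W (beta : {bilinear U -> V -> W}), tens_lift beta x = tens_lift beta y) ->
  x = y.
Proof.
rewrite -[x]reprK -[y]reprK => h; apply/eqP; rewrite piE; apply/asboolP => W beta.
by have := h W beta; rewrite !tens_lift_pi.
Qed.

Definition tens0 : tensor := \pi_tensor [::].
Definition tens_add (x y : tensor) : tensor := \pi_tensor (repr x ++ repr y).
Definition tens_scale (k : K) (x : tensor) : tensor :=
  \pi_tensor [seq (k *: p.1, p.2) | p <- repr x].
Definition tens_opp (x : tensor) : tensor := tens_scale (-1) x.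

Lemma tens_lift0 W (beta : {bilinear U -> V -> W}) : tens_lift beta tens0 = 0.
Proof. by rewrite tens_lift_pi /tens_eval big_nil. Qed.
Lemma tens_liftD W (beta : {bilinear U -> V -> W}) x y :
  tens_lift beta (tens_add x y) = tens_lift beta x + tens_lift beta y.
Proof. by rewrite tens_lift_pi /tens_eval big_cat. Qed.
Lemma tens_liftZ W (beta : {bilinear U -> V -> W}) k x :
  tens_lift beta (tens_scale k x) = k *: tens_lift beta x.
Proof.
rewrite tens_lift_pi /tens_eval big_map scaler_sumr.
by apply: eq_bigr => p _ /=; rewrite linearZl_LR.
Qed.

Let liftE := (tens_lift0, tens_liftD, tens_liftZ).

Lemma tens_addA : associative tens_add.
Proof. by move=> x y z; apply: tensorP => W b; rewrite !liftE addrA. Qed.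
Lemma tens_addC : commutative tens_add.
Proof. by move=> x y; apply: tensorP => W b; rewrite !liftE addrC. Qed.
Lemma tens_add0 : left_id tens0 tens_add.
Proof. by move=> x; apply: tensorP => W b; rewrite !liftE add0r. Qed.
Lemma tens_addN : left_inverse tens0 tens_opp tens_add.
Proof. by move=> x; apply: tensorP => W b; rewrite !liftE scaleN1r addNr. Qed.

HB.instance Definition _ :=
  GRing.isZmodule.Build tensor tens_addA tens_addC tens_add0 tens_addN.

Lemma tens_scaleA k l x : tens_scale k (tens_scale l x) = tens_scale (k * l) x.
Proof. by apply: tensorP => W b; rewrite !liftE scalerA. Qed.
Lemma tens_scale1 : left_id 1 tens_scale.
Proof. by move=> x; apply: tensorP => W b; rewrite !liftE scale1r. Qed.
Lemma tens_scaleDr : right_distributive tens_scale +%R.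
Proof. by move=> k x y; apply: tensorP => W b; rewrite !liftE scalerDr. Qed.
Lemma tens_scaleDl x : {morph tens_scale^~ x : k l / k + l}.
Proof. by move=> k l; apply: tensorP => W b; rewrite !liftE scalerDl. Qed.

HB.instance Definition _ := GRing.Zmodule_isLmodule.Build K tensor
  tens_scaleA tens_scale1 tens_scaleDr tens_scaleDl.

Lemma tens_lift_linear W (beta : {bilinear U -> V -> W}) : linear (tens_lift beta).
Proof. by move=> k x y; rewrite tens_liftD tens_liftZ. Qed.

HB.instance Definition _ W (beta : {bilinear U -> V -> W}) :=
  GRing.isLinear.Build K tensor W *:%R (tens_lift beta) (tens_lift_linear beta).

Lemma tens_liftE W (beta : {bilinear U -> V -> W}) u v :
  tens_lift beta (tens u v) = beta u v.
Proof. by rewrite tens_lift_pi /tens_eval big_seq1. Qed.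

Lemma tens_bilinear : bilinear_for *:%R *:%R tens.
Proof.
split=> [v k u u'|u k v v']; apply: tensorP => W b.
  by rewrite [RHS]tens_lift_linear 3!tens_liftE linearPl.
by rewrite [RHS]tens_lift_linear 3!tens_liftE linearPr.
Qed.

Lemma tens_lift_unique W (beta : {bilinear U -> V -> W}) (h : {linear tensor -> W}) :
  (forall u v, h (tens u v) = beta u v) -> h =1 tens_lift beta.
Proof.
move=> hE x.
have -> : x = \sum_(p <- repr x) tens p.1 p.2.
  apply: tensorP => W' b; rewrite linear_sum /=.
  by under eq_bigr do rewrite tens_liftE.
by rewrite !linear_sum; apply: eq_bigr => p _; rewrite hE /= tens_liftE.
Qed.

End Tensor.

Section LmodQuotient.
Import Quotient.
Variables (K : fieldType) (W : lmodType K) (S : submodClosed W).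

(* A subspace is an additive subgroup, which is what [{quot _}] divides by. *)
Definition lquot_pred : W -> bool := fun x => x \in S.
Fact lquot_pred_zmod_closed : zmod_closed lquot_pred.
Proof. exact: GRing.submod_closedB (submodClosedP S). Qed.
HB.instance Definition _ :=
  GRing.isZmodClosed.Build W lquot_pred lquot_pred_zmod_closed.

Definition lquot_sub : zmodClosed W := GRing.ZmodClosed.clone W lquot_pred _.

Definition lquot : Type := {quot lquot_sub}.
HB.instance Definition _ := GRing.Zmodule.copy lquot {quot lquot_sub}.

Definition lquot_class (x : W) : lquot := \pi_({quot lquot_sub}) x.
Definition lquot_scale (k : K) (q : lquot) : lquot :=
  lquot_class (k *: repr (q : {quot lquot_sub})).

Lemma lquot_classP x y : lquot_class x = lquot_class y <-> x - y \in S.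
Proof. by rewrite -[_ \in S]/(x - y \in lquot_sub) idealrBE; split=> [/eqP|h]; last exact/eqP. Qed.

Lemma lquot_classK (q : lquot) : lquot_class (repr (q : {quot lquot_sub})) = q.
Proof. exact: reprK. Qed.

Lemma lquot_classD x y : lquot_class (x + y) = lquot_class x + lquot_class y.
Proof. exact: (@pi_add W lquot_sub x y). Qed.

Lemma lquot_classZ k x : lquot_class (k *: x) = lquot_scale k (lquot_class x).
Proof.
apply/lquot_classP; rewrite -scalerBr rpredZ //.
by apply/lquot_classP; rewrite lquot_classK.
Qed.

Lemma lquot_scaleA k l q : lquot_scale k (lquot_scale l q) = lquot_scale (k * l) q.
Proof. by rewrite -[q]lquot_classK -!lquot_classZ scalerA. Qed.
Lemma lquot_scale1 : left_id 1 lquot_scale.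
Proof. by move=> q; rewrite -[q]lquot_classK -!lquot_classZ scale1r. Qed.
Lemma lquot_scaleDr : right_distributive lquot_scale +%R.
Proof.
move=> k p q; rewrite -[p]lquot_classK -[q]lquot_classK -lquot_classD -!lquot_classZ.
by rewrite scalerDr lquot_classD.
Qed.
Lemma lquot_scaleDl q : {morph lquot_scale^~ q : k l / k + l}.
Proof.
by move=> k l; rewrite -[q]lquot_classK -!lquot_classZ scalerDl lquot_classD.
Qed.

HB.instance Definition _ := GRing.Zmodule_isLmodule.Build K lquot
  lquot_scaleA lquot_scale1 lquot_scaleDr lquot_scaleDl.

Lemma lquot_class_linear : linear lquot_class.
Proof. by move=> k x y; rewrite lquot_classD lquot_classZ. Qed.
HB.instance Definition _ :=
  GRing.isLinear.Build K W lquot *:%R lquot_class lquot_class_linear.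

End LmodQuotient.

Section Structures.
Variable K : fieldType.

Definition trilinear (A B C D : lmodType K) (f : A -> B -> C -> D) : Prop :=
  [/\ forall b c, linear (fun a => f a b c),
      forall a c, linear (fun b => f a b c)
    & forall a b, linear (fun c => f a b c)].

Record leibniz3 (g : lmodType K) := Leibniz3 {
  br :> g -> g -> g -> g;
  br_trilinear : trilinear br;
  br_leibniz : forall a b x y z,
    br a b (br x y z) = br (br a b x) y z + br x (br a b y) z + br x y (br a b z)
}.

Record representation (g : lmodType K) (L : leibniz3 g) (V : lmodType K) :=
  Representation {
  rhol : g -> g -> V -> V;
  rhom : g -> V -> g -> V;
  rhor : V -> g -> g -> V;
  rhol_trilinear : trilinear rhol;
  rhom_trilinear : trilinear rhom;
  rhor_trilinear : trilinear rhor;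
  rhol_rhol : forall a b x y u,
    rhol a b (rhol x y u) =
    rhol (L a b x) y u + rhol x (L a b y) u + rhol x y (rhol a b u);
  rhol_rhom : forall a b x u z,
    rhol a b (rhom x u z) =
    rhom (L a b x) u z + rhom x (rhol a b u) z + rhom x u (L a b z);
  rhol_rhor : forall a b u y z,
    rhol a b (rhor u y z) =
    rhor (rhol a b u) y z + rhor u (L a b y) z + rhor u y (L a b z);
  rhom_br : forall a u x y z,
    rhom a u (L x y z) =
    rhor (rhom a u x) y z + rhom x (rhom a u y) z + rhol x y (rhom a u z);
  rhor_br : forall u b x y z,
    rhor u b (L x y z) =
    rhor (rhor u b x) y z + rhom x (rhor u b y) z + rhol x y (rhor u b z)
}.

Record cocycle2 (g : lmodType K) (L : leibniz3 g) (V : lmodType K)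
    (rho : representation L V) := Cocycle2 {
  cocycle2_fun :> g -> g -> g -> V;
  cocycle2_trilinear : trilinear cocycle2_fun;
  cocycle2P : forall a b x y z,
    cocycle2_fun a b (L x y z) + rhol rho a b (cocycle2_fun x y z) =
    cocycle2_fun (L a b x) y z + cocycle2_fun x (L a b y) z
    + cocycle2_fun x y (L a b z)
    + rhol rho x y (cocycle2_fun a b z) + rhom rho x (cocycle2_fun a b y) z
    + rhor rho (cocycle2_fun a b x) y z
}.

Record twisted_RB (g : lmodType K) (L : leibniz3 g) (V : lmodType K)
    (rho : representation L V) (Phi : cocycle2 rho) := TwistedRB {
  twisted_RB_fun :> {linear V -> g};
  twisted_RBP : let T := twisted_RB_fun in forall u v w,
    L (T u) (T v) (T w) =
    T (rhol rho (T u) (T v) w + rhom rho (T u) v (T w) + rhor rho u (T v) (T w)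
       + Phi (T u) (T v) (T w))
}.

End Structures.

Section Cohomology.
Variables (K : fieldType) (g : lmodType K) (L : leibniz3 g) (V : lmodType K).
Variables (rho : representation L V) (Phi : cocycle2 rho) (T : twisted_RB Phi).
Local Notation rl := (rhol rho).
Local Notation rm := (rhom rho).
Local Notation rr := (rhor rho).

Definition partial1 (f : V -> g) (u v w : V) : g :=
  - f (rl (T u) (T v) w + rm (T u) v (T w) + rr u (T v) (T w)
       + Phi (T u) (T v) (T w))
  + L (T u) (T v) (f w)
  - T (rm (T u) v (f w) + rr u (T v) (f w) + Phi (T u) (T v) (f w))
  + L (T u) (f v) (T w)
  - T (rl (T u) (f v) w + rr u (f v) (T w) + Phi (T u) (f v) (T w))
  + L (f u) (T v) (T w)
  - T (rl (f u) (T v) w + rm (f u) v (T w) + Phi (f u) (T v) (T w)).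

Definition cocycle1 (f : V -> g) : Prop :=
  linear f /\ forall u v w, partial1 f u v w = 0.

Definition partial0 (a b : g) (u : V) : g :=
  T (rl a b u) + T (Phi a b (T u)) - L a b (T u).

Lemma lincombD (W : lmodType K) k (x x' y y' : W) :
  k *: x + x' + (k *: y + y') = k *: (x + y) + (x' + y').
Proof. by rewrite scalerDr addrACA. Qed.
Lemma lincombN (W : lmodType K) k (x x' : W) :
  - (k *: x + x') = k *: (- x) + (- x').
Proof. by rewrite scalerN opprD. Qed.

Lemma trilinear_subl (A B C D : lmodType K) (f : A -> B -> C -> D) :
  trilinear f -> forall a a' b c, f (a - a') b c = f a b c - f a' b c.
Proof. by case=> h _ _ a a' b c; apply: (zmod_morphism_linear (h b c)). Qed.
Lemma trilinear_subm (A B C D : lmodType K) (f : A -> B -> C -> D) :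
  trilinear f -> forall a b b' c, f a (b - b') c = f a b c - f a b' c.
Proof. by case=> _ h _ a b b' c; apply: (zmod_morphism_linear (h a c)). Qed.
Lemma trilinear_subr (A B C D : lmodType K) (f : A -> B -> C -> D) :
  trilinear f -> forall a b c c', f a b (c - c') = f a b c - f a b c'.
Proof. by case=> _ _ h a b c c'; apply: (zmod_morphism_linear (h a b)). Qed.

Lemma trilinear_addl (A B C D : lmodType K) (f : A -> B -> C -> D) :
  trilinear f -> forall a a' b c, f (a + a') b c = f a b c + f a' b c.
Proof. by case=> h _ _ a a' b c; have [_ ->] := GRing.semilinear_linear (h b c). Qed.
Lemma trilinear_addm (A B C D : lmodType K) (f : A -> B -> C -> D) :
  trilinear f -> forall a b b' c, f a (b + b') c = f a b c + f a b' c.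
Proof. by case=> _ h _ a b b' c; have [_ ->] := GRing.semilinear_linear (h a c). Qed.
Lemma trilinear_addr (A B C D : lmodType K) (f : A -> B -> C -> D) :
  trilinear f -> forall a b c c', f a b (c + c') = f a b c + f a b c'.
Proof. by case=> _ _ h a b c c'; have [_ ->] := GRing.semilinear_linear (h a b). Qed.

Let Ltri := br_trilinear L.
Let ltri := rhol_trilinear rho.
Let mtri := rhom_trilinear rho.
Let rtri := rhor_trilinear rho.
Let Ptri := cocycle2_trilinear Phi.

Let lin1 := (let: And3 h _ _ := Ltri in h, let: And3 h _ _ := ltri in h,
  let: And3 h _ _ := mtri in h, let: And3 h _ _ := rtri in h,
  let: And3 h _ _ := Ptri in h).
Let lin2 := (let: And3 _ h _ := Ltri in h, let: And3 _ h _ := ltri in h,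
  let: And3 _ h _ := mtri in h, let: And3 _ h _ := rtri in h,
  let: And3 _ h _ := Ptri in h).
Let lin3 := (let: And3 _ _ h := Ltri in h, let: And3 _ _ h := ltri in h,
  let: And3 _ _ h := mtri in h, let: And3 _ _ h := rtri in h,
  let: And3 _ _ h := Ptri in h).
Let subl := (trilinear_subl Ltri, trilinear_subl ltri, trilinear_subl mtri,
  trilinear_subl rtri, trilinear_subl Ptri).
Let subm := (trilinear_subm Ltri, trilinear_subm ltri, trilinear_subm mtri,
  trilinear_subm rtri, trilinear_subm Ptri).
Let subr := (trilinear_subr Ltri, trilinear_subr ltri, trilinear_subr mtri,
  trilinear_subr rtri, trilinear_subr Ptri).

Lemma partial1P k (f h : V -> g) u v w :
  partial1 (k *: f + h) u v w = k *: partial1 f u v w + partial1 h u v w.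
Proof.
rewrite /partial1.
rewrite ![(k *: f + h) _](_ : forall x, (k *: f + h) x = k *: f x + h x) //.
by rewrite !(lin1, lin2, lin3) !(lincombD, lincombN, linearP).
Qed.

Lemma partial1_0 u v w : partial1 0 u v w = 0.
Proof.
have := partial1P (-1) 0 0 u v w.
by rewrite scaler0 addr0 scaleN1r addNr.
Qed.

Lemma partial0_linear a b : linear (partial0 a b).
Proof. by move=> k u u'; rewrite /partial0 !(linearP, lin3) !(lincombD, lincombN). Qed.

Lemma partial0Pl k a a' b u :
  partial0 (k *: a + a') b u = k *: partial0 a b u + partial0 a' b u.
Proof. by rewrite /partial0 !lin1 !linearP !(lincombD, lincombN). Qed.

Lemma partial0Pr k a b b' u :
  partial0 a (k *: b + b') u = k *: partial0 a b u + partial0 a b' u.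
Proof. by rewrite /partial0 !lin2 !linearP !(lincombD, lincombN). Qed.

Definition induced_br (u v w : V) : V :=
  rl (T u) (T v) w + rm (T u) v (T w) + rr u (T v) (T w) + Phi (T u) (T v) (T w).

Lemma partial1_cancel (m1 m2 m3 c1 c2 c3 : V) (b1 b2 b3 : g) :
  - (T (m1 - c1 + (m2 - c2) + (m3 - c3))
     - (T m1 - b1 + (T m2 - b2) + (T m3 - b3)))
  + b3 - T c3 + b2 - T c2 + b1 - T c1 = 0.
Proof.
rewrite 2!(linearD T) !linearB /= !opprD.
move: (T m1) (T m2) (T m3) (T c1) (T c2) (T c3) => x1 x2 x3 y1 y2 y3.
rewrite !opprK !addrA.
rewrite [LHS](ACl ((1*7)*(3*9)*(5*11)*(2*18)*(4*16)*(6*14)*(8*17)*(10*15)*(12*13))).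
by rewrite /= !(addNr, subrr, addr0).
Qed.

Lemma partial0_partial1 a b u v w : partial1 (partial0 a b) u v w = 0.
Proof.
rewrite /partial1 -/(induced_br u v w).
set f := partial0 a b.
pose d u := rl a b u + Phi a b (T u).
have Tf u' : L a b (T u') = T (d u') - f u'.
  by rewrite /f /partial0 /d linearD opprB addrC subrK.
have Tmu u' v' w' : L (T u') (T v') (T w') = T (induced_br u' v' w') by exact: twisted_RBP.
have Au : induced_br (d u) v w - (rl (f u) (T v) w + rm (f u) v (T w) + Phi (f u) (T v) (T w))
  = rl (L a b (T u)) (T v) w + rm (L a b (T u)) v (T w) + rr (d u) (T v) (T w)
    + Phi (L a b (T u)) (T v) (T w).
  rewrite !Tf !subl /induced_br !opprD.
  by rewrite [LHS](AC (4*3) (((1*5)*(2*6)*3)*(4*7))).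
have Av : induced_br u (d v) w - (rl (T u) (f v) w + rr u (f v) (T w) + Phi (T u) (f v) (T w))
  = rl (T u) (L a b (T v)) w + rm (T u) (d v) (T w) + rr u (L a b (T v)) (T w)
    + Phi (T u) (L a b (T v)) (T w).
  rewrite !Tf !subm /induced_br !opprD.
  by rewrite [LHS](AC (4*3) (((1*5)*2*(3*6))*(4*7))).
have Aw : induced_br u v (d w) - (rm (T u) v (f w) + rr u (T v) (f w) + Phi (T u) (T v) (f w))
  = rl (T u) (T v) (d w) + rm (T u) v (L a b (T w)) + rr u (T v) (L a b (T w))
    + Phi (T u) (T v) (L a b (T w)).
  rewrite !Tf !subr /induced_br !opprD.
  by rewrite [LHS](AC (4*3) ((1*(2*5)*(3*6))*(4*7))).
have dmu : d (induced_br u v w) =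
  (induced_br (d u) v w - (rl (f u) (T v) w + rm (f u) v (T w) + Phi (f u) (T v) (T w))) +
  (induced_br u (d v) w - (rl (T u) (f v) w + rr u (f v) (T w) + Phi (T u) (f v) (T w))) +
  (induced_br u v (d w) - (rm (T u) v (f w) + rr u (T v) (f w) + Phi (T u) (T v) (f w))).
  rewrite Au Av Aw {1}/d -Tmu {Au Av Aw} /induced_br !(trilinear_addr ltri).
  rewrite rhol_rhol rhol_rhom rhol_rhor -!addrA.
  rewrite [rl a b (Phi _ _ _) + _]addrC cocycle2P.
  rewrite (trilinear_addm mtri) (trilinear_addl rtri).
  by rewrite !addrA [RHS](ACl (1*6*11*2*7*13*3*9*14*5*10*15*12*8*4)).
have -> : f (induced_br u v w) = T (d (induced_br u v w)) - L a b (T (induced_br u v w)).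
  by rewrite Tf opprB addrC subrK.
have -> : L a b (T (induced_br u v w)) = T (induced_br (d u) v w) - L (f u) (T v) (T w)
    + (T (induced_br u (d v) w) - L (T u) (f v) (T w))
    + (T (induced_br u v (d w)) - L (T u) (T v) (f w)).
  by rewrite -!Tmu br_leibniz !Tf (trilinear_subl Ltri) (trilinear_subm Ltri)
             (trilinear_subr Ltri).
by rewrite dmu; apply: partial1_cancel.
Qed.

(* Z^1_T(V, g) is carved out of the space of all functions V -> g, whence the
   linearity condition in [cocycle1]. *)
Definition is_cocycle1 : pred (V -> g) := fun f => `[< cocycle1 f >].

Fact is_cocycle1_submod_closed : submod_closed is_cocycle1.
Proof.
split.
  apply/asboolP; split; last exact: partial1_0.
  by move=> k x y; rewrite [RHS](_ : _ = k *: 0 + 0) // scaler0 addr0.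
move=> k f h /asboolP[fl f0] /asboolP[hl h0]; apply/asboolP; split.
  move=> l x y; have E z : (k *: f + h) z = k *: f z + h z by [].
  by rewrite !E fl hl !scalerDr !scalerA mulrC addrACA.
by move=> u v w; rewrite partial1P f0 h0 scaler0 addr0.
Qed.
HB.instance Definition _ :=
  GRing.isSubmodClosed.Build K (V -> g) is_cocycle1 is_cocycle1_submod_closed.

Record Z1 := MkZ1 { Z1_fun :> V -> g; Z1_cocycle : Z1_fun \in is_cocycle1 }.
HB.instance Definition _ := [isSub for Z1_fun].
HB.instance Definition _ := [Choice of Z1 by <:].
HB.instance Definition _ := [SubChoice_isSubLmodule of Z1 by <:].

Definition wp (a b : g) : Z1 :=
  MkZ1 (introT (asboolP _) (conj (partial0_linear a b) (partial0_partial1 a b))).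

Fact wp_bilinear : bilinear_for *:%R *:%R wp.
Proof.
split=> [b k a a'|a k b b']; apply/val_inj/funext => u /=.
  by rewrite partial0Pl.
by rewrite partial0Pr.
Qed.
HB.instance Definition _ :=
  bilinear_isBilinear.Build K g g Z1 *:%R *:%R wp wp_bilinear.

Definition coboundary : {linear tensor g g -> Z1} := tens_lift wp.

Lemma coboundaryE a b u : coboundary (tens a b) u = partial0 a b u.
Proof. by rewrite /coboundary /= tens_liftE. Qed.

Definition is_coboundary : pred Z1 := fun f => `[< exists x, f = coboundary x >].

Fact is_coboundary_submod_closed : submod_closed is_coboundary.
Proof.
split; first by apply/asboolP; exists 0; rewrite linear0.
move=> k _ _ /asboolP[x ->] /asboolP[y ->]; apply/asboolP.
by exists (k *: x + y); rewrite linearP.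
Qed.
HB.instance Definition _ :=
  GRing.isSubmodClosed.Build K Z1 is_coboundary is_coboundary_submod_closed.
Definition B1 : submodClosed Z1 := GRing.SubmodClosed.clone K Z1 is_coboundary _.

Definition HH1 : lmodType K := lquot B1.
Definition HH1_class : {linear Z1 -> HH1} := @lquot_class K Z1 B1.

End Cohomology.

(** A series sum_i w_i t^i with coefficients in W is the sequence (w_i) of its
    coefficients, and w in W is identified with the constant series [cst w]. *)
Section Series.
Variable K : fieldType.
Implicit Types A B C D : lmodType K.

Definition cst A (x : A) : nat -> A := fun n => if n is 0 then x else 0.

(* (sum_i F_i t^i) (sum_j x_j t^j) *)
Definition ser_app A B (F : nat -> A -> B) (x : nat -> A) : nat -> B :=
  fun n => \sum_(i < n.+1) \sum_(j < n.+1 | (i + j == n)%N) F i (x j).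

(* The K[[t]]-trilinear extension of a trilinear map. *)
Definition ser_tri A B C D (f : A -> B -> C -> D)
    (x : nat -> A) (y : nat -> B) (z : nat -> C) : nat -> D :=
  fun n => \sum_(i < n.+1) \sum_(j < n.+1) \sum_(k < n.+1 | (i + j + k == n)%N)
             f (x i) (y j) (z k).

Lemma ser_app0 A B (F : nat -> A -> B) (x : nat -> A) :
  ser_app F x 0%N = F 0%N (x 0%N).
Proof. by rewrite /ser_app big_ord1 big_mkcond big_ord1. Qed.
Lemma ser_app1 A B (F : nat -> A -> B) (x : nat -> A) :
  ser_app F x 1%N = F 0%N (x 1%N) + F 1%N (x 0%N).
Proof.
rewrite /ser_app !big_ord_recl big_ord0 !(big_mkcond (fun _ => _ == _)).
by rewrite !big_ord_recl !big_ord0 /= !(addr0, add0r).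
Qed.
Lemma ser_tri0 A B C D (f : A -> B -> C -> D) x y z :
  ser_tri f x y z 0%N = f (x 0%N) (y 0%N) (z 0%N).
Proof. by rewrite /ser_tri !big_ord1 big_mkcond big_ord1. Qed.
Lemma ser_tri1 A B C D (f : A -> B -> C -> D) x y z :
  ser_tri f x y z 1%N =
  f (x 0%N) (y 0%N) (z 1%N) + f (x 0%N) (y 1%N) (z 0%N) + f (x 1%N) (y 0%N) (z 0%N).
Proof.
rewrite /ser_tri !big_ord_recl !big_ord0 !(big_mkcond (fun _ => _ == _)).
by rewrite !big_ord_recl !big_ord0 /= !(addr0, add0r).
Qed.

End Series.

Section Deformation.
Variables (K : fieldType) (g : lmodType K) (L : leibniz3 g) (V : lmodType K).
Variables (rho : representation L V) (Phi : cocycle2 rho) (T : twisted_RB Phi).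

Record deformation := Deformation {
  dcoef :> nat -> {linear V -> g};
  dcoef0 : dcoef 0%N =1 T;
  deformationP : forall u v w : V,
    let Tt (x : V) : nat -> g := ser_app dcoef (cst x) in
    ser_tri L (Tt u) (Tt v) (Tt w) =
    ser_app dcoef
      (fun n => ser_tri (rhol rho) (Tt u) (Tt v) (cst w) n
              + ser_tri (rhom rho) (Tt u) (cst v) (Tt w) n
              + ser_tri (rhor rho) (cst u) (Tt v) (Tt w) n
              + ser_tri Phi (Tt u) (Tt v) (Tt w) n)
}.

Lemma dcoef1_cocycle (Tt : deformation) : cocycle1 T (Tt 1%N).
Proof.
split=> [|u v w]; first exact: linearP.
have lin0 (A B : lmodType K) (h : A -> B) : linear h -> h 0 = 0.
  by move=> /zmod_morphism_linear /(_ 0 0); rewrite !subrr.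
have l0 x y : rhol rho x y 0 = 0 by case: (rhol_trilinear rho) => _ _ /(_ x y) /lin0.
have m0 x y : rhom rho x 0 y = 0 by case: (rhom_trilinear rho) => _ /(_ x y) /lin0.
have r0 x y : rhor rho 0 x y = 0 by case: (rhor_trilinear rho) => /(_ x y) /lin0.
have := congr1 (fun s : nat -> g => s 1%N) (deformationP Tt u v w).
rewrite !(ser_app1, ser_app0, ser_tri1, ser_tri0) /= !(linear0, dcoef0) !(l0, m0, r0, add0r).
rewrite !addr0 !addrA [X in T X + _](ACl ((3*5*7)*(1*6*8)*(2*4*9))) /= 2!(linearD T).
rewrite /partial1; set X := Tt 1%N (_ + _ + _ + _).
set C3 := T (_ + _ + _); set C2 := T (_ + _ + _); set C1 := T (_ + _ + _).
move=> h; rewrite [LHS](ACl ((2*4*6)*(3*5*7)*1)) /= h.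
by rewrite -!opprD -addrA -opprD subrr.
Qed.

Definition infinitesimal (Tt : deformation) : Z1 T :=
  MkZ1 (introT (asboolP _) (dcoef1_cocycle Tt)).

(* id + t [a, b, .] + sum_(i >= 2) eta_i t^i; eta_0 and eta_1 are not used. *)
Definition equiv_f (a b : g) (eta : nat -> {linear g -> g}) (n : nat) : g -> g :=
  match n with
  | 0 => id
  | 1 => L a b
  | _ => eta n
  end.

(* id + t (rho^l(a, b, .) + Phi(a, b, T .)) + sum_(i >= 2) zeta_i t^i *)
Definition equiv_g (a b : g) (zeta : nat -> {linear V -> V}) (n : nat) : V -> V :=
  match n with
  | 0 => id
  | 1 => fun u => rhol rho a b u + Phi a b (T u)
  | _ => zeta n
  end.

Definition equivalent (Tt' Tt : deformation) : Prop :=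
  exists (a b : g) (eta : nat -> {linear g -> g}) (zeta : nat -> {linear V -> V}),
  let F := ser_app (equiv_f a b eta) in
  let G := ser_app (equiv_g a b zeta) in
  [/\ forall x y z, F (cst (L x y z)) = ser_tri L (F (cst x)) (F (cst y)) (F (cst z)),
      [/\ forall x y u, G (cst (rhol rho x y u)) =
            ser_tri (rhol rho) (F (cst x)) (F (cst y)) (G (cst u)),
          forall x u y, G (cst (rhom rho x u y)) =
            ser_tri (rhom rho) (F (cst x)) (G (cst u)) (F (cst y)),
          forall u x y, G (cst (rhor rho u x y)) =
            ser_tri (rhor rho) (G (cst u)) (F (cst x)) (F (cst y))
        & forall x y z, G (cst (Phi x y z)) =
            ser_tri Phi (F (cst x)) (F (cst y)) (F (cst z))]
    & forall u, F (ser_app (fun i => Tt' i) (cst u)) = ser_app (fun i => Tt i) (G (cst u))].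

End Deformation.

(* Main.v *)
Require Import Defs.
From mathcomp Require Import all_boot all_algebra.
From mathcomp Require Import boolp.
Import GRing.Theory.
Local Open Scope ring_scope.

(** The order-one parts of f_t and g_t are prescribed by a and b, so at order t the intertwining
    relation reads T'_1 + [a, b, T .] = T_1 + T(rho^l(a, b, .) + Phi(a, b, T .)). Hence T'_1 - T_1
    is exactly the coboundary [wp T a b]. *)

(* Comparing the coefficients of t in f_t (T'_t u) = T_t (g_t u). *)
Lemma equivalent_infinitesimal_sub (K : fieldType) (g : lmodType K)
    (L : leibniz3 g) (V : lmodType K) (rho : representation L V)
    (Phi : cocycle2 rho) (T : twisted_RB Phi) (Tt' Tt : deformation T) :
  equivalent Tt' Tt ->
  exists a b : g, infinitesimal Tt' - infinitesimal Tt = wp T a b.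
Proof.
case=> a [b [eta [zeta [_ _ FT]]]]; exists a, b.
apply/val_inj/funext => u.
have := congr1 (fun s : nat -> g => s 1%N) (FT u).
(* [linear0] removes the terms in the t-coefficient of [cst u], which is 0. *)
rewrite !(ser_app1, ser_app0) /= !dcoef0 !linear0 !add0r linearD => eq1.
rewrite [LHS](_ : _ = Tt' 1%N u - Tt 1%N u) //= /partial0.
by apply/eqP; rewrite subr_eq addrAC -eq1 addrK.
Qed.

Theorem theorem6p6 (K : closedFieldType) (charK : [pchar K] =i pred0)
    (g : lmodType K) (L : leibniz3 g) (V : lmodType K) (rho : representation L V)
    (Phi : cocycle2 rho) (T : twisted_RB Phi) (Tt' Tt : deformation T) :
  equivalent Tt' Tt ->
  HH1_class T (infinitesimal Tt') = HH1_class T (infinitesimal Tt).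
Proof.
move=> /equivalent_infinitesimal_sub [a [b eq_ab]].
(* [coboundary] is the lift of [wp] to the tensor product, so a pure tensor is a preimage. *)
apply/lquot_classP/asboolP; exists (tens a b).
by rewrite eq_ab /coboundary /= tens_liftE.
Qed.
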